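(* Let $B>1$ and $N>1$ be integers with $\gcd(N,B)=1$, let $e=\operatorname{ord}(B,N)$, and suppose $N\in M_2(B)$ (in particular $e$ is even). Then for every even divisor $d$ of $e$ we have $N\in M_d(B)$, and for every $x$ with $1\le x<N$, $\gcd(x,N)=1$, the multiplier satisfies $m_d(x)=d/2$, i.e. $S_d(x)=\tfrac d2\,(B^{e/d}-1)$.
   Context: $\operatorname{ord}(B,N)$ is the least positive integer $e$ with $B^e\equiv1\pmod N$. For a divisor $d$ of $e$ put $k=e/d$. For $x$ with $1\le x<N$, $\gcd(x,N)=1$, let $x/N=0.a_1a_2\ldots$ be its base-$B$ expansion (purely periodic with period $a_1\ldots a_e$), and let $S_d(x)=\sum_{j=1}^d\sum_{i=1}^k a_{(j-1)k+i}B^{k-i}$ be the sum of the integers represented in base $B$ by the $d$ consecutive blocks of length $k$ of the period. We say $N\in M_d(B)$ if $d\mid e$ and $S_d(x)\equiv0\pmod{B^k-1}$ for every such $x$. When $N\in M_d(B)$, the multiplier is the integer $m_d(x)=S_d(x)/(B^k-1)$. *)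

(* Defs.v *)
From mathcomp Require Import all_boot all_fingroup all_solvable.

Set Implicit Arguments.
Unset Strict Implicit.
Unset Printing Implicit Defensive.

Lemma mult_order_subproof (B N : nat) :
  exists e, (0 < e) && (coprime B N ==> (B ^ e == 1 %[mod N])).
Proof.
case: (posnP N) => [-> | N_gt0].
  by exists 1; apply/implyP; rewrite /coprime gcdn0 => /eqP ->.
exists (totient N); rewrite totient_gt0 N_gt0 /=.
by apply/implyP => cBN; apply/eqP/Euler_exp_totient.
Qed.

(* ord(B, N): the least e > 0 with B ^ e = 1 mod N when B and N are coprime;
   no such e need exist otherwise, and then the value is the junk value 1. *)
Definition mult_order (B N : nat) : nat := ex_minn (mult_order_subproof B N).

Lemma mult_orderP (B N : nat) : coprime B N ->
  [/\ 0 < mult_order B N,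
      B ^ mult_order B N = 1 %[mod N]
    & forall f, 0 < f -> B ^ f = 1 %[mod N] -> mult_order B N <= f].
Proof.
rewrite /mult_order => cBN; case: ex_minnP => e; rewrite cBN /=.
case/andP=> e_gt0 /eqP Be min_e; split=> // f f_gt0 Bf.
by apply: min_e; rewrite f_gt0; apply/eqP.
Qed.

(* The i-th digit a_i (i >= 1) of the base-B expansion 0.a_1 a_2 ... of x / N,
   for x < N: the last base-B digit of floor (B ^ i * x / N). *)
Definition digit (B N x i : nat) : nat := (B ^ i * x %/ N) %% B.

Lemma digit_lt (B N x i : nat) : 0 < B -> digit B N x i < B.
Proof. exact: ltn_pmod. Qed.

(* Divided by B ^ n * N: x / N exceeds the sum of the a_i / B ^ i for i <= n
   by a nonnegative amount smaller than 1 / B ^ n. *)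
Lemma digit_expansion (B N x n : nat) : 0 < B -> x < N ->
  B ^ n * x =
    (\sum_(1 <= i < n.+1) digit B N x i * B ^ (n - i)) * N + B ^ n * x %% N.
Proof.
move=> B_gt0 x_lt_N; have N_gt0 : 0 < N by apply: leq_ltn_trans x_lt_N.
rewrite [LHS](divn_eq _ N); congr (_ * N + _).
elim: n => [|n IHn]; first by rewrite big_nil mul1n divn_small.
rewrite big_nat_recr //= subnn muln1.
rewrite [LHS](divn_eq _ B); congr (_ + _).
rewrite -divnMA mulnC expnS -mulnA (mulnC N) divnMl // IHn mulnC big_distrl /=.
apply: eq_big_nat => i /andP[_ i_le_n].
by rewrite -mulnA -expnSr subSn.
Qed.

(* S_d(x), with blocks of length k = ord(B, N) / d. *)
Definition block_sum (d B N x : nat) : nat :=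
  let k := mult_order B N %/ d in
  \sum_(1 <= j < d.+1) \sum_(1 <= i < k.+1)
     digit B N x ((j - 1) * k + i) * B ^ (k - i).

(* N \in M_d(B) *)
Definition midy (d B N : nat) : Prop :=
  d %| mult_order B N /\
  forall x, 1 <= x < N -> coprime x N ->
    block_sum d B N x = 0 %[mod B ^ (mult_order B N %/ d) - 1].

(* m_d(x); the division is exact when midy d B N holds. *)
Definition multiplier (d B N x : nat) : nat :=
  block_sum d B N x %/ (B ^ (mult_order B N %/ d) - 1).

(* Main.v *)
Require Import Defs.
From mathcomp Require Import all_boot.

(** Let [r_j] be the residue of [B ^ (j * k) * x] modulo [N].  The [j]-th block of the
    period is the quotient of [B ^ k * r_(j-1)] by [N], with remainder [r_j]; summing over
    a whole period, [N * S_d(x) = (B ^ k - 1) * (r_0 + ... + r_(d-1))].  For [d = 2] the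
    hypothesis thus says that [N] divides [r_0 + r_1], which lies strictly between [0] and
    [2 * N], so that [x + (B ^ (e / 2) * x mod N) = N] for every unit [x].  For even [d],
    apply this to the units [r_0, ..., r_(d/2 - 1)]: the residues pair up as
    [r_j + r_(j + d/2) = N]. *)

(** Replacing [B ^ m * x] by its residue changes the floor by a multiple of [B ^ i], which is
    invisible modulo [B] because [i > 0]. *)
Lemma digit_shift (B N x m i : nat) : 0 < N -> 0 < i ->
  digit B N x (m + i) = digit B N (B ^ m * x %% N) i.
Proof.
move=> N_gt0; case: i => // i _; rewrite /digit addnC expnD -mulnA.
rewrite {1}(divn_eq (B ^ m * x) N) mulnDr mulnA divnMDl //.
by rewrite expnS -[B * _ * _ in LHS]mulnA mulnC modnMDl.
Qed.

Lemma block_expansion (B N x m k : nat) : 0 < B -> 0 < N ->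
  B ^ k * (B ^ m * x %% N) =
    (\sum_(1 <= i < k.+1) digit B N x (m + i) * B ^ (k - i)) * N
    + B ^ (m + k) * x %% N.
Proof.
move=> B_gt0 N_gt0.
rewrite (digit_expansion k B_gt0 (ltn_pmod (B ^ m * x) N_gt0)).
rewrite modnMmr mulnA -expnD (addnC k); congr (_ * N + _).
by apply: eq_big_nat => i /andP[i_gt0 _]; rewrite digit_shift.
Qed.

Lemma block_sum_mulN (d B N x : nat) :
    0 < B -> coprime B N -> d %| mult_order B N -> x < N ->
  let k := mult_order B N %/ d in
  block_sum d B N x * N = (B ^ k - 1) * \sum_(0 <= j < d) B ^ (j * k) * x %% N.
Proof.
move=> B_gt0 cBN d_e x_N k; have N_gt0 : 0 < N by apply: leq_ltn_trans x_N.
pose r j := B ^ (j * k) * x %% N.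
have r_d : r d = r 0.
  have [_ Be _] := mult_orderP cBN.
  by rewrite /r /k [d * _]mulnC divnK // -modnMml Be modnMml.
have r_shift : \sum_(0 <= j < d) r j.+1 = \sum_(0 <= j < d) r j.
  apply: (@addnI (r 0)); rewrite -[LHS](big_nat_recl d 0 r) //.
  by rewrite big_nat_recr //= r_d addnC.
(* Adding the residue sum to both sides removes the truncated subtraction in [B ^ k - 1]; on the
   left it enters in shifted form, as the remainders of the blocks. *)
apply: (@addIn (\sum_(0 <= j < d) r j)).
rewrite mulnBl mul1n subnK ?leq_pmull ?expn_gt0 ?B_gt0 //.
rewrite -{1}r_shift /block_sum big_add1 /= big_distrl -big_split big_distrr /=.
apply: eq_bigr => j _.
by rewrite subn1 /= block_expansion // /r mulSn (addnC k).
Qed.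

Lemma coprime_expM_mod (B N x m : nat) : coprime B N -> coprime x N ->
  coprime (B ^ m * x %% N) N.
Proof. by move=> cBN cxN; rewrite coprime_modl coprimeMl coprimeXl. Qed.

Lemma coprime_gt0 (N x : nat) : 1 < N -> coprime x N -> 0 < x.
Proof. by case: x => //; rewrite /coprime gcd0n; case: N => [|[]]. Qed.

(** Since [d] divides a positive order, the block length is at least 1. This allows cancelling
    [B ^ k - 1] and dividing by it. *)
Lemma block_modulus_gt0 (d B N : nat) :
  1 < B -> coprime B N -> d %| mult_order B N -> 0 < B ^ (mult_order B N %/ d) - 1.
Proof.
move=> B_gt1 cBN d_e; have [e_gt0 _ _] := mult_orderP cBN.
rewrite subn_gt0 -(expn0 B) ltn_exp2l // divn_gt0 ?(dvdn_leq e_gt0) //.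
exact: dvdn_gt0 d_e.
Qed.

Lemma midy2_complement (B N x : nat) :
    1 < B -> 1 < N -> coprime B N -> midy 2 B N -> x < N -> coprime x N ->
  x + B ^ (mult_order B N %/ 2) * x %% N = N.
Proof.
move=> B_gt1 N_gt1 cBN [e2 midyB] x_N cxN; have N_gt0 := ltnW N_gt1.
have x_gt0 := coprime_gt0 _ _ N_gt1 cxN.
have := midyB x; rewrite x_gt0 x_N => /(_ isT cxN).
move/eqP; rewrite mod0n => /dvdnP[m Sm].
have := block_sum_mulN _ _ _ _ (ltnW B_gt1) cBN e2 x_N.
rewrite /= Sm mulnAC mulnC => /eqP; rewrite eqn_pmul2l ?block_modulus_gt0 //.
(* For [d = 2] the residues are [x] itself, as [x < N], and its complement. *)
rewrite !big_nat_recr //= big_nil add0n mul0n mul1n expn0 mul1n modn_small // => /eqP Em.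
have y_N := ltn_pmod (B ^ (mult_order B N %/ 2) * x) N_gt0.
have m_gt0 : 0 < m * N by rewrite Em addn_gt0 x_gt0.
have m_lt2 : m * N < 2 * N by rewrite Em mul2n -addnn -addSn leq_add // ltnW.
move: Em m_gt0 m_lt2; rewrite muln_gt0 ltn_pmul2r // => <- /andP[].
by case: m {Sm} => [|[|m]] //; rewrite mul1n.
Qed.

Lemma block_sum_even (d B N x : nat) :
    1 < B -> 1 < N -> coprime B N -> midy 2 B N ->
    d %| mult_order B N -> 2 %| d -> x < N -> coprime x N ->
  block_sum d B N x = d %/ 2 * (B ^ (mult_order B N %/ d) - 1).
Proof.
move=> B_gt1 N_gt1 cBN midyB d_e d2 x_N cxN; have N_gt0 := ltnW N_gt1.
apply/eqP; rewrite -(eqn_pmul2r N_gt0) (block_sum_mulN _ _ _ _ (ltnW B_gt1)) //.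
rewrite (mulnC (d %/ 2)) -mulnA; apply/eqP; congr (_ * _).
set k := mult_order B N %/ d; set h := d %/ 2.
have def_d : d = h + h by rewrite addnn -muln2 divnK.
have hk : h * k = mult_order B N %/ 2.
  by rewrite -[in RHS](divnK d_e) -/k -muln_divA // mulnC.
(* Cut the residue sum at [h] and reindex the upper half by [j + h]. *)
rewrite def_d (big_cat_nat (n := h)) ?leq_addr //=.
rewrite -{2}[h]add0n big_addn addnK -big_split /=.
transitivity (\sum_(0 <= j < h) N); last by rewrite sum_nat_const_nat subn0.
apply: eq_bigr => j _.
(* As [h * k] is half the order, the later residue is that of [B ^ (e / 2)] times the unit [r_j]. *)
rewrite mulnDl [_ + h * k]addnC hk expnD -[_ * _ * x]mulnA -[X in _ + X]modnMmr.
by rewrite midy2_complement ?ltn_pmod ?coprime_expM_mod.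
Qed.

Theorem theorem6 (B N : nat) (hB : 1 < B) (hN : 1 < N) (hNB : coprime N B)
    (hM2 : midy 2 B N) (d : nat) (hd : d %| mult_order B N) (hd2 : 2 %| d) :
  midy d B N /\
  forall x : nat, 1 <= x < N -> coprime x N ->
    multiplier d B N x = d %/ 2 /\
    block_sum d B N x = d %/ 2 * (B ^ (mult_order B N %/ d) - 1).
Proof.
have cBN : coprime B N by rewrite coprime_sym.
have S_d x : 1 <= x < N -> coprime x N ->
    block_sum d B N x = d %/ 2 * (B ^ (mult_order B N %/ d) - 1).
  by case/andP=> _ x_N cxN; apply: block_sum_even.
split=> [|x x_N cxN].
  by split=> // x x_N cxN; rewrite S_d // modnMl mod0n.
by rewrite /multiplier S_d // mulnK ?block_modulus_gt0.
Qed.
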